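(* Let $Z\subset[-1,1]$ be a finite set, let $Z_{(1)},\dots,Z_{(l)}\subset Z$ be the support sets of $l$ rational approximations on $Z$, each of degree $m-1$ (so each support set has $m$ points), put $m^+:=2\left|\bigcup_{\mu=1}^l Z_{(\mu)}\right|-2$, and let $Z^{\mathrm{e}}\subset Z$. Suppose $f:=n/d=p/q$ is a rational function on $[-1,1]$ of degree $m-1$, defined by support points and weights $(Z_m,W_m)$, with $Z_m\subset[-1,1]$. Then if $Z_m^+=Z_m\cup Z^{\mathrm{e}}$, any AAA approximant $\hat f=\hat n/\hat d=\hat p/\hat q$ of $f$ of degree at most $m-1$ such that $$\|\hat d f-\hat n\|_{Z_m^+,\infty}<\epsilon$$ satisfies $$\|p\hat q-\hat p q\|_{[-1,1],\infty}<\|q\|_{[-1,1],\infty}\,\|\hat\ell\|_{[-1,1],\infty}\,B(Z^{\mathrm{e}},m^+)\,\epsilon,$$ where $\hat\ell$ is the node polynomial for $\hat f$.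
   Context: For a set $S$, $\|g\|_{S,\infty}:=\sup_{z\in S}|g(z)|$, and $\epsilon>0$. Barycentric form: given pairwise distinct support points $Z_m=\{z_1,\dots,z_m\}$ and nonzero complex weights $W_m=(w_1,\dots,w_m)$ with $\sum_\nu|w_\nu|^2=1$, the rational function $f=n/d$ defined by them has $n(z)=\sum_{\nu=1}^m\frac{w_\nu f(z_\nu)}{z-z_\nu}$ and $d(z)=\sum_{\nu=1}^m\frac{w_\nu}{z-z_\nu}$. Its node polynomial is $\ell(z)=\prod_{\nu=1}^m(z-z_\nu)$, and $p:=\ell n$, $q:=\ell d$ are polynomials of degree at most $m-1$ with $f=p/q$; $f$ is said to have degree $m-1$. AAA approximant: the AAA algorithm, run on the sample set $S=Z_m^+$, builds barycentric rational functions $r_j=n_j/d_j$, $j=1,2,\dots$, with $n_j(z)=\sum_{\nu=1}^j\frac{\hat w_\nu f(\hat z_\nu)}{z-\hat z_\nu}$ and $d_j(z)=\sum_{\nu=1}^j\frac{\hat w_\nu}{z-\hat z_\nu}$, as follows. At iteration $j$ the new support point is chosen greedily as $\hat z_j=\arg\max_{z\in S\setminus\{\hat z_1,\dots,\hat z_{j-1}\}}|f(z)-r_{j-1}(z)|$, and then the weights $\hat w_1,\dots,\hat w_j$ (depending on $j$), subject to $\sum_\nu|\hat w_\nu|^2=1$, are chosen so that the $2$-norm of $d_jf-n_j$ over $S\setminus\{\hat z_1,\dots,\hat z_j\}$ is minimal. An AAA approximant of degree $k-1$ is $\hat f=\hat n/\hat d:=n_k/d_k$; its node polynomial is $\hat\ell(z)=\prod_{\nu=1}^k(z-\hat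 z_\nu)$, and $\hat p=\hat\ell\hat n$, $\hat q=\hat\ell\hat d$. Barycentric expressions are understood in the limit sense at support points. With $\mathbb{P}_{M}$ the space of polynomials of degree at most $M$, $$B(Z^{\mathrm{e}},M):=\sup\{\|g\|_{[-1,1],\infty}\;:\;g\in\mathbb{P}_M,\ \|g\|_{Z^{\mathrm{e}},\infty}\le1\}.$$ *)

(* Defs.v *)
From HB Require Import structures.
From mathcomp Require Import all_boot all_order all_algebra finmap.
From mathcomp Require Import complex.
From mathcomp Require Import all_classical all_reals all_analysis.

Set Implicit Arguments.
Unset Strict Implicit.
Unset Printing Implicit Defensive.

Import Order.TTheory GRing.Theory Num.Theory numFieldNormedType.Exports.
Import ComplexField.Normc.

Local Open Scope classical_set_scope.
Local Open Scope ring_scope.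
Local Open Scope complex_scope.

(* [normc] is the R-valued modulus on R[i]; the ring norm `|_| is R[i]-valued. *)

Section Norms.
Variable R : realType.

(* Values of barycentric expressions are taken as limits over punctured
   neighbourhoods, so nothing depends on the convention x / 0 = 0 at support
   points. The limit of the modulus lives in \bar R: it is +oo at a pole, while
   [limit_value] is meant for points where the limit exists in R[i]. *)
Definition limit_value (g : R[i] -> R[i]) (x : R) : R[i] :=
  lim ((g w : R[i]^o) @[w --> (x%:C : R[i]^o)^']).

Definition limit_modulus (g : R[i] -> R[i]) (x : R) : \bar R :=
  lim ((normc (g w))%:E @[w --> (x%:C : R[i]^o)^']).

Definition sup_norm (A : set R) (g : R[i] -> R[i]) : \bar R :=
  ereal_sup [set (normc (g x%:C))%:E | x in A].

Definition limit_sup_norm (A : set R) (g : R[i] -> R[i]) : \bar R :=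
  ereal_sup [set limit_modulus g x | x in A].

Definition limit_two_norm (A : {fset R}) (g : R[i] -> R[i]) : \bar R :=
  sqrte (\sum_(x <- A) limit_modulus g x ^+ 2)%E.

(* The competitors are complex polynomials, and B may be +oo (for instance when
   Ze has at most M points). *)
Definition B (Ze : {fset R}) (M : nat) : \bar R :=
  ereal_sup [set sup_norm `[-1, 1] (horner g) | g in
    [set g : {poly R[i]} | (size g <= M.+1)%N /\
       (sup_norm [set` Ze] (horner g) <= 1)%E]].

End Norms.

Section BarycentricForms.
Variables (R : realType) (m : nat).
Implicit Types (z : 'I_m -> R) (w v : 'I_m -> R[i]) (x : R[i]).

Definition bary_num z w v x : R[i] :=
  \sum_(nu < m) w nu * v nu / (x - (z nu)%:C).

Definition bary_den z w x : R[i] := \sum_(nu < m) w nu / (x - (z nu)%:C).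

Definition bary_fun z w v x : R[i] := bary_num z w v x / bary_den z w x.

Definition node_poly z : {poly R[i]} := \prod_(nu < m) ('X - ((z nu)%:C)%:P).

(* The products (node polynomial) * n and (node polynomial) * d, as polynomials;
   see [num_polyE] and [den_polyE]. *)
Definition num_poly z w v : {poly R[i]} :=
  \sum_(nu < m) (w nu * v nu) *: \prod_(mu < m | mu != nu) ('X - ((z mu)%:C)%:P).

Definition den_poly z w : {poly R[i]} :=
  \sum_(nu < m) w nu *: \prod_(mu < m | mu != nu) ('X - ((z mu)%:C)%:P).

Lemma num_polyE z w v x : (forall nu, x != (z nu)%:C) ->
  (num_poly z w v).[x] = (node_poly z).[x] * bary_num z w v x.
Proof.
move=> xz; rewrite /num_poly /bary_num mulr_sumr horner_sum.
apply: eq_bigr => nu _; rewrite hornerZ /node_poly [in RHS](bigD1 nu) //=.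
rewrite hornerM hornerXsubC -[LHS]mulr1.
have /divff <- : x - (z nu)%:C != 0 by rewrite subr_eq0.
rewrite !mulrA; congr (_ / _).
by rewrite [LHS]mulrC (mulrC (w nu * v nu)) !mulrA.
Qed.

Lemma den_polyE z w x : (forall nu, x != (z nu)%:C) ->
  (den_poly z w).[x] = (node_poly z).[x] * bary_den z w x.
Proof.
move=> xz; have := @num_polyE z w (fun=> 1) x xz.
rewrite /num_poly /bary_num /den_poly /bary_den.
under eq_bigr do rewrite mulr1.
by under [in RHS]eq_bigr do rewrite mulr1.
Qed.

End BarycentricForms.

(* [bval nu] is the prescribed value f(z_nu); the function itself, [bfun],
   attains it at [bpt nu] in the limit since [bwt nu != 0]. *)
Record barycentric (R : realType) (m : nat) := Barycentric {
  bpt : 'I_m -> R;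
  bwt : 'I_m -> R[i];
  bval : 'I_m -> R[i];
  bpt_inj : injective bpt;
  bwt_neq0 : forall nu, bwt nu != 0;
  bwt_norm : \sum_(nu < m) normc (bwt nu) ^+ 2 = 1
}.

Section OfBarycentric.
Variables (R : realType) (m : nat) (r : barycentric R m).

Definition bsupp : {fset R} := [fset bpt r nu | nu in 'I_m]%fset.
Definition bfun : R[i] -> R[i] := bary_fun (bpt r) (bwt r) (bval r).
Definition bp : {poly R[i]} := num_poly (bpt r) (bwt r) (bval r).
Definition bq : {poly R[i]} := den_poly (bpt r) (bwt r).

End OfBarycentric.

(* Iteration j + 1 of AAA picks the support point [z j] and the weights
   [w j.+1], so that r_j has support points [z 0], ..., [z j.-1] and weights
   [w j]. The constant [r0] is the initial approximant compared with f at the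
   first iteration (usually the mean of f over the sample set). *)
Section AAA.
Variables (R : realType) (f : R[i] -> R[i]).
Variables (z : nat -> R) (w : forall j : nat, 'I_j -> R[i]).

Definition aaa_pt (j : nat) : 'I_j -> R := fun nu => z nu.
Definition aaa_val (j : nat) : 'I_j -> R[i] := fun nu => limit_value f (z nu).

Definition aaa_fun (r0 : R[i]) (j : nat) : R[i] -> R[i] :=
  if j is 0 then fun=> r0 else bary_fun (@aaa_pt j) (@w j) (@aaa_val j).

Definition aaa_gap (r0 : R[i]) (j : nat) (x : R[i]) : R[i] :=
  f x - aaa_fun r0 j x.

(* d f - n for the first j support points and the weights u *)
Definition aaa_residual (j : nat) (u : 'I_j -> R[i]) (x : R[i]) : R[i] :=
  bary_den (@aaa_pt j) u x * f x - bary_num (@aaa_pt j) u (@aaa_val j) x.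

Definition aaa_rest (S : {fset R}) (j : nat) : {fset R} :=
  [fset x in S | x \notin [seq z i | i <- iota 0 j]]%fset.

Definition aaa_run (S : {fset R}) (r0 : R[i]) (k : nat) : Prop :=
  forall j : nat, (j < k)%N ->
  [/\ z j \in aaa_rest S j,
      forall x, x \in aaa_rest S j ->
        (limit_modulus (aaa_gap r0 j) x <= limit_modulus (aaa_gap r0 j) (z j))%E,
      \sum_(nu < j.+1) normc (@w j.+1 nu) ^+ 2 = 1 &
      forall u : 'I_j.+1 -> R[i], \sum_(nu < j.+1) normc (u nu) ^+ 2 = 1 ->
        (limit_two_norm (aaa_rest S j.+1) (aaa_residual (@w j.+1)) <=
         limit_two_norm (aaa_rest S j.+1) (aaa_residual u))%E].

End AAA.

(* Main.v *)
(** Clearing denominators, [p * qhat - phat * q = q * lhat * (dhat * f - nhat)]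
    away from finitely many points. This polynomial has degree at most
    [2 * m - 2 <= mplus]; on [Ze] it is bounded by
    [sup |q| * sup |lhat| * c] with [c < eps], because the residual has limit
    modulus at most [c] there, so the definition of [B] bounds it on [-1, 1].
    Since [B >= 1], replacing [c] by [eps] makes the inequality strict; when
    [B = +oo] it holds because a polynomial is bounded on [-1, 1]. *)

Require Import Defs.
From HB Require Import structures.
From mathcomp Require Import all_boot all_order all_algebra finmap.
From mathcomp Require Import complex.
From mathcomp Require Import all_classical all_reals all_analysis.
From mathcomp Require Import zify ring.

Set Implicit Arguments.
Unset Strict Implicit.
Unset Printing Implicit Defensive.

Import Order.TTheory GRing.Theory Num.Theory numFieldNormedType.Exports.
Import ComplexField.Normc.

Local Open Scope classical_set_scope.
Local Open Scope ring_scope.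

(** * Continuity of polynomials and isolation of their zeros *)

Section HornerTopology.
Variable K : numFieldType.
Implicit Types (p : {poly K}) (x : K^o).

Lemma continuous_horner_regular p : continuous (fun x : K^o => p.[x] : K^o).
Proof.
elim/poly_ind: p => [|p c IH] x.
  have -> : (fun x : K^o => (0 : {poly K}).[x] : K^o) = cst 0.
    by apply/funext => y; rewrite horner0.
  exact: cst_continuous.
have -> : (fun x : K^o => (p * 'X + c%:P).[x] : K^o) =
    (fun x : K^o => p.[x] * x + c : K^o).
  by apply/funext => y; rewrite hornerMXaddC.
apply: (@continuousD K K^o K^o (fun y => p.[y] * y) (cst c)); last exact: cst_continuous.
by apply: (@continuousM K K^o (fun y => p.[y]) id); [exact: IH|exact: cvg_id].
Qed.

(** Factoring out the full power of ['X - x] leaves a cofactor [q] with [q.[x] != 0], which by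
    continuity stays nonzero nearby; the extracted power vanishes only at [x] itself. *)
Lemma near_horner_neq0 p x : p != 0 -> \forall w \near x^', p.[w] != 0.
Proof.
move=> p0; have [n [q + ->]] := multiplicity_XsubC p x; rewrite p0 /= => qx.
have qnear : \forall w \near x^', q.[w] != 0.
  by apply: nbhs_dnbhs; apply: (cvgr_neq0 _ (@continuous_horner_regular q x)).
near=> w.
rewrite hornerM horner_exp hornerXsubC mulf_neq0 ?expf_neq0 ?subr_eq0//.
  by near: w.
by near: w; exact: nbhs_dnbhs_neq.
Unshelve. all: by end_near. Qed.

End HornerTopology.

(** * The real-valued modulus and limits of moduli of fractions *)

Section Modulus.
Variable R : realType.
Implicit Types (P D : {poly R[i]}) (a b x : R[i]).

Lemma norm_normc a : `|a| = (normc a)%:C%C.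
Proof. by case: a. Qed.

Lemma normc_ge0 a : 0 <= normc a.
Proof. by case: a => s t; exact: sqrtr_ge0. Qed.

Lemma normc_gt0 a : (0 < normc a) = (a != 0).
Proof.
rewrite lt_neqAle normc_ge0 andbT eq_sym; congr negb.
by apply/eqP/eqP => [/eq0_normc//|->]; rewrite normc0.
Qed.

Lemma normc_dist a b : `|normc a - normc b| <= normc (a - b).
Proof.
have h s t : normc s - normc t <= normc (s - t).
  by rewrite lerBlDr; have := le_normcD (s - t) t; rewrite subrK.
by rewrite ler_norml h andbT lerNl opprB -(normcN (a - b)) opprB h.
Qed.

Lemma continuous_normc : continuous (@normc R : R[i]^o -> R^o).
Proof.
move=> a; have Fa := nbhs_filter a.
apply/(@cvgrPdist_lt R R^o _ (nbhs a) Fa) => e e0.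
(* The norm of [R[i]] takes values in [R[i]], so the radius has to be embedded there. *)
have e0C : 0 < e%:C%C by rewrite ltcR.
have := @cvgr_dist_lt R[i] R[i]^o _ (nbhs a) Fa id a cvg_id _ e0C.
apply: filterS => b; rewrite norm_normc ltcR.
exact: le_lt_trans (normc_dist _ _).
Qed.

Lemma normc_horner_cvg P (x : R[i]^o) :
  (normc P.[w] : R^o) @[w --> x] --> (normc P.[x] : R^o).
Proof.
exact: (continuous_comp (@continuous_horner_regular _ P x)
  (@continuous_normc _)).
Qed.

(** Multiplying by the denominator gives a bound that keeps its meaning where [D] vanishes: there it
    forces [P] to vanish too. This is how a bound on limits at support points or poles becomes one
    on polynomial values. *)
Lemma limit_modulus_frac_le (g : R[i] -> R[i]) P D (x c : R) :
  D != 0 -> 0 <= c ->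
  (\forall w \near (x%:C%C : R[i]^o)^', g w = P.[w] / D.[w]) ->
  (limit_modulus g x <= c%:E)%E ->
  normc P.[x%:C%C] <= c * normc D.[x%:C%C].
Proof.
move=> D0 c0; set X : R[i]^o := x%:C%C => gE gc.
have Dnear := @near_horner_neq0 _ D X D0.
have gnear : \forall w \near (X : R[i]^o)^', normc (g w) = normc P.[w] / normc D.[w].
  by apply: filterS gE => w ->; rewrite normcM normcV.
have Pcvg : (normc P.[w] : R^o) @[w --> (X : R[i]^o)^'] --> (normc P.[X] : R^o).
  by move=> A /(@normc_horner_cvg P X); exact: nbhs_dnbhs.
have Dcvg : (normc D.[w] : R^o) @[w --> (X : R[i]^o)^'] --> (normc D.[X] : R^o).
  by move=> A /(@normc_horner_cvg D X); exact: nbhs_dnbhs.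
have [DX0|DX0] := eqVneq D.[X] 0.
  (* A zero of [D] that is not a zero of [P] would be a pole of [g]. *)
  rewrite DX0 normc0 mulr0 leNgt; apply/negP => PX.
  suff gy : (normc (g w))%:E @[w --> (X : R[i]^o)^'] --> (+oo%E : \bar R).
    by move: gc; rewrite /limit_modulus (cvg_lim _ gy) //; exact: ereal_hausdorff.
  apply/cvgeyPge => A; near=> w.
  have Dw : 0 < normc D.[w] by rewrite normc_gt0; near: w.
  have -> : normc (g w) = normc P.[w] / normc D.[w] by near: w.
  rewrite lee_fin ler_pdivlMr//.
  (* Near [X] the modulus of [P] exceeds half its value at [X], while that of [D] falls below this
     half divided by [|A| + 1]; the added 1 makes the divisor positive. *)
  apply: (@le_trans _ _ (normc P.[X] / 2)); last first.
    near: w; apply: (cvgr_ge _ Pcvg).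
    by rewrite ltr_pdivrMr// mulr2n mulrDr mulr1 ltrDl.
  apply: (@le_trans _ _ ((`|A| + 1) * normc D.[w])).
    by rewrite ler_wpM2r ?normc_ge0// (le_trans (ler_norm A))// lerDl.
  rewrite mulrC -ler_pdivlMr ?ltr_wpDl//.
  near: w; apply: (cvgr_le _ Dcvg); by rewrite DX0 normc0 divr_gt0 ?divr_gt0//.
have DXn : 0 < normc D.[X] by rewrite normc_gt0.
have gl : (normc (g w))%:E @[w --> (X : R[i]^o)^'] --> (normc P.[X] / normc D.[X])%:E.
  apply: cvg_EFin; first by apply: nearW.
  apply: (@cvg_trans _ ((normc P.[w] / normc D.[w] : R^o) @[w --> (X : R[i]^o)^'])).
    by apply: near_eq_cvg; apply: filterS gnear => w.
  by apply: cvgM => //; apply: cvgV => //; rewrite gt_eqF.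
move: gc; rewrite /limit_modulus (cvg_lim _ gl) ?lee_fin ?ler_pdivrMr//.
Unshelve. all: by end_near. Qed.


End Modulus.

(** * Sup norms on [-1, 1] and the constant [B] *)

Local Notation unit_itv := `[(-1)%R, 1%R]%classic.

Section SupNorm.
Variable R : realType.
Implicit Types (P : {poly R[i]}) (A : set R) (Ze : {fset R}).

Lemma le_sup_norm A (g : R[i] -> R[i]) (x : R) :
  A x -> ((normc (g x%:C%C))%:E <= sup_norm A g)%E.
Proof. by move=> Ax; apply: ereal_sup_ubound; exists x. Qed.

Lemma sup_norm_le A (g : R[i] -> R[i]) (c : \bar R) :
  (forall x, A x -> (normc (g x%:C%C))%:E <= c)%E -> (sup_norm A g <= c)%E.
Proof. by move=> h; apply: ge_ereal_sup => _ [x Ax <-]; exact: h. Qed.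

(** Since [|x| <= 1], each Horner step adds at most the modulus of one coefficient. *)
Lemma sup_norm_horner_lty P : (sup_norm unit_itv (horner P) < +oo)%E.
Proof.
suff [M hM] : exists M : R, forall x, unit_itv x -> normc P.[x%:C%C] <= M.
  apply: le_lt_trans (ltry M); apply: sup_norm_le => x Ix.
  by rewrite lee_fin hM.
elim/poly_ind: P => [|P c [M hM]].
  by exists 0 => x _; rewrite horner0 normc0.
exists (M + normc c) => x Ix; rewrite hornerMXaddC.
apply: le_trans (le_normcD _ _) _; rewrite lerD2r normcM.
apply: le_trans (hM _ Ix); rewrite ler_piMr ?normc_ge0//.
rewrite /normc /= expr0n /= addr0 sqrtr_sqr ler_norml.
by move: Ix; rewrite /= in_itv.
Qed.

(** The points [1 / (i + 1)] with [i < size P] are distinct, lie in the interval and outnumber the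
    possible roots of [P]. *)
Lemma sup_norm_horner_gt0 P : P != 0 -> (0 < sup_norm unit_itv (horner P))%E.
Proof.
move=> P0; pose s : seq R := [seq i.+1%:R^-1 | i <- iota 0 (size P)].
have us : uniq (map (real_complex R) s).
  rewrite map_inj_uniq ?map_inj_uniq ?iota_uniq//; last exact: complexI.
  by move=> i j /invr_inj /(mulrIn (oner_neq0 _)) [].
have /allPn [_ /mapP[x xs ->] Px] : ~~ all (root P) (map (real_complex R) s).
  apply/negP => /(max_poly_roots P0) /(_ us).
  by rewrite !size_map size_iota ltnn.
apply: lt_le_trans (le_sup_norm (x := x) _ _); first by rewrite lte_fin normc_gt0.
move: xs => /mapP[i _ ->]; rewrite /= in_itv /= invf_le1 ?ler1n ?ltr0n// andbT.
by rewrite (le_trans (lerN10 R)).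
Qed.

(** Dividing [P] by [K] yields a competitor in the supremum that defines [B]. *)
Lemma sup_norm_le_B Ze M P (K : R) : (size P <= M.+1)%N -> 0 < K ->
  (forall x, x \in Ze -> normc P.[x%:C%C] <= K) ->
  (sup_norm unit_itv (horner P) <= K%:E * B Ze M)%E.
Proof.
move=> sP K0 PK; pose g := (K^-1)%:C%C *: P.
have gE x : normc g.[x] = K^-1 * normc P.[x].
  rewrite hornerZ normcM; congr (_ * _).
  by rewrite /normc /= expr0n /= addr0 sqrtr_sqr ger0_norm ?invr_ge0 ?ltW.
have gB : (sup_norm unit_itv (horner g) <= B Ze M)%E.
  apply: ereal_sup_ubound; exists g => //; split.
    by rewrite (leq_trans (size_scale_leq _ _)).
  by apply: sup_norm_le => x xZ; rewrite lee_fin gE mulrC ler_pdivrMr ?mul1r ?PK.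
apply: sup_norm_le => x Ix.
have -> : normc P.[x%:C%C] = K * normc g.[x%:C%C] by rewrite gE mulVKf ?gt_eqF.
rewrite EFinM lee_pmul2l// ?lte_fin//.
exact: le_trans (le_sup_norm _ Ix) gB.
Qed.

(** The constant polynomial 1 is a competitor. *)
Lemma B_ge1 Ze M : (1 <= B Ze M)%E.
Proof.
apply: (@le_trans _ _ (sup_norm unit_itv (horner (1 : {poly R[i]})))).
  have := @le_sup_norm unit_itv (horner (1 : {poly R[i]})) 0.
  by rewrite hornerC normc1; apply; rewrite /= in_itv /= lerN10 ler01.
apply: ereal_sup_ubound; exists 1 => //; split; first by rewrite size_poly1.
by apply: sup_norm_le => x _; rewrite hornerC normc1.
Qed.

End SupNorm.

(** * Barycentric polynomials and the AAA residual as a fraction *)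

Section BarycentricPolynomials.
Variables (R : realType) (m : nat).
Implicit Types (z : 'I_m -> R) (w v : 'I_m -> R[i]) (x : R[i]).

Lemma size_num_poly z w v : (size (num_poly z w v) <= m)%N.
Proof.
apply: (leq_trans (size_sum _ _ _)); apply/bigmax_leqP => nu _.
apply: (leq_trans (size_scale_leq _ _)).
apply: (leq_trans (size_poly_prod_leq _ _)).
under eq_bigr do rewrite size_XsubC.
rewrite sum_nat_const cardC1 card_ord; have := ltn_ord nu; lia.
Qed.

Lemma size_den_poly z w : (size (den_poly z w) <= m)%N.
Proof.
have := @size_num_poly z w (fun=> 1); rewrite /num_poly /den_poly.
by under eq_bigr do rewrite mulr1.
Qed.

Lemma node_poly_neq0 z : node_poly z != 0.
Proof. by apply/prodf_neq0 => nu _; rewrite polyXsubC_eq0. Qed.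

Lemma node_poly_root z x : (node_poly z).[x] != 0 -> forall nu, x != (z nu)%:C%C.
Proof.
rewrite horner_prod => /prodf_neq0 h nu.
by have := h nu isT; rewrite hornerXsubC subr_eq0.
Qed.

(** At a support point only the summand of that point survives: a nonzero weight times differences
    of distinct points. *)
Lemma bq_neq0 (f : barycentric R m) : (0 < m)%N -> bq f != 0.
Proof.
move=> m0; pose nu := Ordinal m0.
apply/negP => /eqP /(congr1 (fun p => p.[(bpt f nu)%:C%C])).
rewrite horner0 horner_sum (bigD1 nu) //= [X in _ + X]big1 ?addr0 => [|mu numu].
  apply/eqP; rewrite hornerZ mulf_neq0 ?bwt_neq0// horner_prod.
  apply/prodf_neq0 => mu numu; rewrite hornerXsubC subr_eq0.
  by apply: contra numu => /eqP /complexI /bpt_inj ->.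
rewrite hornerZ (bigD1 nu) 1?eq_sym//= hornerM hornerXsubC subrr.
by rewrite mul0r mulr0.
Qed.

Lemma card_bsupp (f : barycentric R m) : #|` bsupp f| = m.
Proof.
rewrite card_imfset /=; last exact: bpt_inj.
by rewrite -cardE card_ord.
Qed.

End BarycentricPolynomials.

(** Off the support points, [f] is [bp f / bq f], and its approximant's barycentric sums are
    polynomials over the node polynomial, so the residual gets the form required by
    [limit_modulus_frac_le]. *)
Lemma aaa_residual_horner (R : realType) (m : nat) (f : barycentric R m)
    (z : nat -> R) (k : nat) (u : 'I_k -> R[i]) (x : R[i]) :
  let zh := @aaa_pt R z k in
  (bq f).[x] != 0 -> (node_poly (bpt f)).[x] != 0 -> (node_poly zh).[x] != 0 ->
  aaa_residual (bfun f) z u x =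
  (bp f * den_poly zh u - num_poly zh u (aaa_val (bfun f) z (j := k)) * bq f).[x]
  / (bq f * node_poly zh).[x].
Proof.
move=> zh qx lx lhx.
have fE : bfun f x = (bp f).[x] / (bq f).[x].
  rewrite /bp /bq (num_polyE _ _ (node_poly_root lx)).
  by rewrite (den_polyE _ (node_poly_root lx)) -mulf_div divff// mul1r.
rewrite /aaa_residual fE -/zh !(hornerM, hornerD, hornerN).
rewrite (num_polyE _ _ (node_poly_root lhx)) (den_polyE _ (node_poly_root lhx)).
by field; rewrite qx lhx.
Qed.

(** * The bound for the cross-multiplied difference of [f] and its approximant *)

Theorem theorem4p4 (R : realType) (m l : nat)
    (Z : {fset R}) (Z_sub : forall x, x \in Z -> -1 <= x <= 1)
    (l_gt0 : (0 < l)%N) (r : 'I_l -> barycentric R m)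
    (r_sub : forall mu : 'I_l, (bsupp (r mu) `<=` Z)%fset)
    (Ze : {fset R}) (Ze_sub : (Ze `<=` Z)%fset)
    (f : barycentric R m) (f_sub : forall x, x \in bsupp f -> -1 <= x <= 1)
    (eps : R) (eps_gt0 : 0 < eps)
    (r0 : R[i]) (k : nat) (k_gt0 : (0 < k)%N) (k_le : (k <= m)%N)
    (z : nat -> R) (w : forall j : nat, 'I_j -> R[i]) :
  let I : set R := `[-1, 1]%classic in
  let mplus := (2 * #|` (\bigcup_(mu in 'I_l) bsupp (r mu))%fset | - 2)%N in
  let Zmplus := (bsupp f `|` Ze)%fset in
  let p := bp f in
  let q := bq f in
  let zh := @aaa_pt R z k in
  let phat := num_poly zh (w k) (aaa_val (bfun f) z (j := k)) in
  let qhat := den_poly zh (w k) in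
  let lhat := node_poly zh in
  aaa_run (bfun f) z w Zmplus r0 k ->
  (limit_sup_norm [set` Zmplus] (aaa_residual (bfun f) z (w k)) < eps%:E)%E ->
  (sup_norm I (horner (p * qhat - phat * q)) <
   sup_norm I (horner q) * sup_norm I (horner lhat) *
   B Ze mplus * eps%:E)%E.
Proof.
move=> I mplus Zmplus p q zh phat qhat lhat _ res_lt.
set P := p * qhat - phat * q.
have m0 : (0 < m)%N by exact: leq_trans k_le.
have q0 : q != 0 := bq_neq0 f m0.
have l0 : lhat != 0 := node_poly_neq0 zh.
(* Both products have size at most [m + k - 1 <= 2 * m - 1]. A single support set already has [m]
   points, so the union has at least [m >= 1], and the subtraction in [mplus] does not truncate. *)
have sP : (size P <= mplus.+1)%N.
  have mN : (m <= #|` (\bigcup_(mu in 'I_l) bsupp (r mu))%fset |)%N.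
    rewrite -[leqLHS](card_bsupp (r (Ordinal l_gt0))).
    by apply: fsubset_leq_card; apply: bigfcup_sup.
  apply: leq_trans (size_polyD _ _) _; rewrite size_polyN geq_max.
  apply/andP; split; apply: leq_trans (size_polyMleq _ _) _.
    have sp : (size p <= m)%N by exact: size_num_poly.
    have sqh : (size qhat <= k)%N by exact: size_den_poly.
    rewrite /mplus; lia.
  have sph : (size phat <= k)%N by exact: size_num_poly.
  have sq : (size q <= m)%N by exact: size_den_poly.
  rewrite /mplus; move: (size phat) (size q) sph sq => a b; lia.
(* The maximum with [eps / 2] keeps [c] positive, because the scaling in [sup_norm_le_B] divides by
   it. *)
have [c c_gt0 [c_lt res_le]] : exists2 c : R, 0 < c & c < eps /\
    (limit_sup_norm [set` Zmplus] (aaa_residual (bfun f) z (w k)) <= c%:E)%E.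
  move: res_lt; case: (limit_sup_norm _ _) => [s|//|].
  - rewrite lte_fin => s_lt; exists (Num.max s (eps / 2)).
      by rewrite lt_max divr_gt0 ?orbT.
    rewrite lee_fin le_max lexx gt_max s_lt; split=> //.
    by rewrite ltr_pdivrMr// mulr_natr mulr2n ltrDl.
  - move=> _; exists (eps / 2); first exact: divr_gt0.
    by rewrite leNye; split=> //; rewrite ltr_pdivrMr// mulr_natr mulr2n ltrDl.
(* Both sup norms are positive and finite, so they can be replaced by positive reals. *)
have := sup_norm_horner_gt0 q0; have := sup_norm_horner_lty q.
have := sup_norm_horner_gt0 l0; have := sup_norm_horner_lty lhat.
rewrite -/I; move sqE: (sup_norm I (horner q)) => sq.
move slE: (sup_norm I (horner lhat)) => sl.
case: sl slE => [sl||//] slE // _; rewrite lte_fin => sl_gt0.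
case: sq sqE => [sq||//] sqE // _; rewrite lte_fin => sq_gt0.
have P_le x : x \in Ze -> normc P.[x%:C%C] <= sq * sl * c.
  move=> xZe; have Ix : I x.
    by rewrite /I /= in_itv /= Z_sub// (fsubsetP Ze_sub).
  apply: (@le_trans _ _ (c * normc (q * lhat).[x%:C%C])).
    apply: (@limit_modulus_frac_le _ (aaa_residual (bfun f) z (w k))).
    - by rewrite mulf_neq0.
    - exact: ltW.
    (* The product collects all points where the fraction formula may fail; a punctured
       neighbourhood of [x] avoids its zeros. *)
    - have := @near_horner_neq0 _ (q * lhat * node_poly (bpt f)) x%:C%C.
      rewrite !mulf_neq0// ?node_poly_neq0// => /(_ isT).
      apply: filterS => y; rewrite !hornerM !mulf_eq0 !negb_or.
      by move=> /andP[/andP[qy ly] fy]; rewrite aaa_residual_horner// !hornerM.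
    - apply: le_trans res_le; apply: ereal_sup_ubound; exists x => //=.
      by rewrite in_fsetU xZe orbT.
  rewrite mulrC ler_pM2r// hornerM normcM ler_pM ?normc_ge0//.
  - by rewrite -lee_fin -sqE; exact: le_sup_norm.
  - by rewrite -lee_fin -slE; exact: le_sup_norm.
have K_gt0 : 0 < sq * sl * c by rewrite !mulr_gt0.
have := sup_norm_le_B sP K_gt0 P_le; have := B_ge1 Ze mplus.
(* The bound [1 <= B] excludes [-oo] and makes a finite [B] positive, so multiplying [c < eps] by it
   stays strict. *)
rewrite -/I; case: (B Ze mplus) => [b||//].
  rewrite lee_fin => b_ge1 /le_lt_trans; apply.
  rewrite -!EFinM lte_fin -!mulrA !ltr_pM2l// mulrC ltr_pM2l//.
  exact: lt_le_trans b_ge1.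
move=> _ _; rewrite -EFinM gt0_muley ?lte_fin ?mulr_gt0//.
by rewrite mulyr gtr0_sg// mul1e; exact: sup_norm_horner_lty.
Qed.
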